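(* Let $W(z)=\dfrac{\arctan\sqrt{2e^{-z}-1}}{\sqrt{2e^{-z}-1}}$, with principal branches of $\arctan$ and the square root. For $|z|<\ln2$, \[ W(z)=\sum_{n=0}^{\infty}(-1)^n\Bigg[\frac{\pi}{4}\sum_{k=0}^{n}(-1)^kS(n,k)(2k-1)!!+\sum_{k=1}^{n}(-1)^kS(n,k)\frac{k!}{2^k}\sum_{\ell=1}^{k}(-1)^{\ell}\binom{2k-\ell}{k}\frac{2^{\ell/2}}{\ell}\sin\frac{3\ell\pi}{4}\Bigg]\frac{z^n}{n!}. \]
   Context: $S(n,k)$ are the Stirling numbers of the second kind, given by $\frac{(e^x-1)^k}{k!}=\sum_{n\ge k}S(n,k)\frac{x^n}{n!}$. Double factorials: $(2k-1)!!=1\cdot3\cdots(2k-1)$ for $k\ge1$, and $(-1)!!=1$. An empty sum is $0$. *)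

(* Defs.v *)
From Stdlib Require Import Reals Arith.
From Coquelicot Require Import Coquelicot.

Definition Cexp (z : C) : C :=
  (exp (Re z) * cos (Im z), exp (Re z) * sin (Im z))%R.

(** Principal argument, with values in (-PI, PI]. *)
Definition Carg (z : C) : R :=
  let x := Re z in let y := Im z in
  if Rlt_dec 0 x then atan (y / x)
  else if Rlt_dec x 0 then
         (if Rle_dec 0 y then atan (y / x) + PI else atan (y / x) - PI)%R
  else if Rlt_dec 0 y then (PI / 2)%R
  else if Rlt_dec y 0 then (- (PI / 2))%R
  else 0%R.

(** Principal logarithm (only used at nonzero arguments). *)
Definition Clog (z : C) : C := (ln (Cmod z), Carg z).

(** Principal square root: Re >= 0, and Im >= 0 on the cut (negative reals). *)
Definition Csqrt (z : C) : C :=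
  let x := Re z in let y := Im z in
  (sqrt ((Cmod z + x) / 2),
   (if Rle_dec 0 y then 1 else -1) * sqrt ((Cmod z - x) / 2))%R.

Definition Carctan (w : C) : C :=
  (Ci / 2 * (Clog (1 - Ci * w) - Clog (1 + Ci * w)))%C.

Definition W (z : C) : C :=
  let w := Csqrt (2 * Cexp (- z) - 1)%C in (Carctan w / w)%C.

Fixpoint stirling2 (n k : nat) : nat :=
  match n, k with
  | O, O => 1
  | O, S _ => 0
  | S _, O => 0
  | S n', S k' => S k' * stirling2 n' (S k') + stirling2 n' k'
  end.

(** odd_dfact k = (2k-1)!! = 1*3*...*(2k-1), with odd_dfact 0 = (-1)!! = 1. *)
Fixpoint odd_dfact (k : nat) : nat :=
  match k with
  | O => 1
  | S k' => (2 * k' + 1) * odd_dfact k'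
  end.

(** The bracketed coefficient, including the sign (-1)^n.  sum_n_m a p q is
    the sum over p <= i <= q, and is 0 when q < p. *)
Definition coefW (n : nat) : R :=
  ((-1) ^ n *
   (PI / 4 * sum_n_m (fun k => (-1) ^ k * INR (stirling2 n k) * INR (odd_dfact k)) 0 n
    + sum_n_m (fun k => (-1) ^ k * INR (stirling2 n k) * (INR (fact k) / 2 ^ k)
         * sum_n_m (fun l => (-1) ^ l * Binomial.C (2 * k - l) k
                              * Rpower 2 (INR l / 2) / INR l
                              * sin (3 * INR l * PI / 4)) 1 k) 1 n))%R.

(* Main.v *)
Require Import Defs.
From Stdlib Require Import Reals Arith Lra Lia.
From Coquelicot Require Import Coquelicot.

(** Put [x = exp (-z) - 1], so that [w ^ 2 = 2 exp (-z) - 1 = 1 + 2 x] and [|x| < 1].  Expanding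
    [arctan w / w = int_0^1 dt / (1 + w^2 t^2) = int_0^1 dt / (1 + t^2 + 2 x t^2)]
    as a geometric series in [x] gives [sum_k (-x)^k e_k], where
    [e_k = int_0^1 (2 t^2)^k / (1 + t^2)^(k+1) dt] lies in [[0, 1]] and satisfies
    [(k+1) e_(k+1) = (2k+1) e_k - 1/2]; the closed form in the statement solves the same
    recurrence.  Substituting [x^k = k! sum_n S(n,k) (-z)^n / n!] and exchanging the two sums
    finishes the proof; the exchange is legitimate because
    [sum_n k! S(n,k) |z|^n / n! = (exp |z| - 1)^k] and [exp |z| - 1 < 1] for [|z| < ln 2]. *)

Local Open Scope R_scope.

(** * Derivatives of complex-valued functions of a real variable *)

(** No integral is ever formed. An integral over [0, 1] is replaced by an explicit function of its
    upper limit, and a truncated expansion is compared with its limit by differentiating along the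
    segment and applying the mean value inequality. Only real-variable derivatives are needed, but
    the logarithms inside [Carctan] must stay off their cut along the whole segment; the condition
    [0 < Re w] secures this. The bound |z| < ln 2 therefore serves once more, to keep 2 e^(-z) - 1
    off the cut of the square root. Stirling numbers enter as finite differences: (e^y - 1)^k is the
    k-th difference at 0 of j |-> e^(j y), and k! S(n,k) is that of j |-> j^n, so their generating
    function follows from the exponential series alone. The sines in the closed form are imaginary
    parts of powers of 1 - i; its recurrence comes down to summing them against ballot numbers. *)

Lemma C_ext (a b : C) : Re a = Re b -> Im a = Im b -> a = b.
Proof. destruct a, b; simpl; intros; subst; reflexivity. Qed.

(** Differentiation takes place only along a real parameter, so componentwise derivatives suffice
    and the real mean value theorem applies to each component. *)
Definition Cder (f : R -> C) (t : R) (d : C) : Prop :=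
  is_derive (fun s => Re (f s)) t (Re d) /\ is_derive (fun s => Im (f s)) t (Im d).

Lemma Cder_eq f t d d' : Cder f t d -> d = d' -> Cder f t d'.
Proof. intros H <-; exact H. Qed.

Lemma Cder_ext_loc f g t d :
  locally t (fun s => f s = g s) -> Cder f t d -> Cder g t d.
Proof.
  intros E [H1 H2]; split.
  - refine (is_derive_ext_loc _ _ _ _ _ H1).
    apply (filter_imp _ _ (fun s Hs => f_equal Re Hs) E).
  - refine (is_derive_ext_loc _ _ _ _ _ H2).
    apply (filter_imp _ _ (fun s Hs => f_equal Im Hs) E).
Qed.

Lemma Cder_const c t : Cder (fun _ => c) t 0.
Proof. split; exact (is_derive_const _ _). Qed.

Lemma Cder_RtoC f t d : is_derive f t d -> Cder (fun s => RtoC (f s)) t (RtoC d).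
Proof. intros H; split; [exact H | exact (is_derive_const _ _)]. Qed.

Lemma Cder_plus f g t df dg :
  Cder f t df -> Cder g t dg -> Cder (fun s => f s + g s)%C t (df + dg)%C.
Proof.
  intros [f1 f2] [g1 g2]; split.
  - exact (is_derive_plus _ _ _ _ _ f1 g1).
  - exact (is_derive_plus _ _ _ _ _ f2 g2).
Qed.

Lemma is_derive_Rmult (f g : R -> R) t df dg :
  is_derive f t df -> is_derive g t dg ->
  is_derive (fun s => f s * g s) t (df * g t + f t * dg).
Proof. intros Hf Hg; exact (is_derive_mult _ _ _ _ _ Hf Hg Rmult_comm). Qed.

Lemma Cder_mult f g t df dg :
  Cder f t df -> Cder g t dg ->
  Cder (fun s => f s * g s)%C t (df * g t + f t * dg)%C.
Proof.
  intros [f1 f2] [g1 g2]; split.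
  - evar_last.
    exact (is_derive_minus _ _ _ _ _ (is_derive_Rmult _ _ _ _ _ f1 g1)
             (is_derive_Rmult _ _ _ _ _ f2 g2)).
    cbv [minus plus opp]; simpl; unfold Re, Im; ring.
  - evar_last.
    exact (is_derive_plus _ _ _ _ _ (is_derive_Rmult _ _ _ _ _ f1 g2)
             (is_derive_Rmult _ _ _ _ _ f2 g1)).
    cbv [minus plus opp]; simpl; unfold Re, Im; ring.
Qed.

Lemma Cder_scal c f t df : Cder f t df -> Cder (fun s => c * f s)%C t (c * df)%C.
Proof.
  intros H; eapply Cder_eq; [exact (Cder_mult _ _ _ _ _ (Cder_const c t) H) | cbv beta; ring].
Qed.

Lemma Cder_minus f g t df dg :
  Cder f t df -> Cder g t dg -> Cder (fun s => f s - g s)%C t (df - dg)%C.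
Proof.
  intros Hf Hg.
  apply (Cder_eq _ _ (df + (-1) * dg)%C); [| ring].
  apply (Cder_ext_loc (fun s => f s + (-1) * g s)%C).
  - apply filter_forall; intros s; ring.
  - apply Cder_plus; [exact Hf | apply Cder_scal, Hg].
Qed.

Lemma sum_n_CS (f : nat -> C) n : sum_n f (S n) = (sum_n f n + f (S n))%C.
Proof. apply (sum_Sn f n). Qed.

Lemma Cder_sum_n (f : nat -> R -> C) (df : nat -> C) t N :
  (forall k, Cder (f k) t (df k)) ->
  Cder (fun s => sum_n (fun k => f k s) N) t (sum_n df N).
Proof.
  intros H; induction N as [|N IH].
  - rewrite sum_O. apply (Cder_ext_loc (f 0%nat)); [| apply H].
    apply filter_forall; intros s; rewrite sum_O; reflexivity.
  - rewrite sum_n_CS.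
    apply (Cder_ext_loc (fun s => sum_n (fun k => f k s) N + f (S N) s)%C).
    + apply filter_forall; intros s; rewrite sum_n_CS; reflexivity.
    + apply Cder_plus; auto.
Qed.

Lemma im_le_Cmod (c : C) : Rabs (Im c) <= Cmod c.
Proof. eapply Rle_trans; [apply Rmax_r | apply (Rmax_Cmod c)]. Qed.

Lemma Cmod_le_Rabs (c : C) : Cmod c <= Rabs (Re c) + Rabs (Im c).
Proof.
  replace c with (RtoC (Re c) + Ci * RtoC (Im c))%C at 1
    by (apply C_ext; simpl; ring).
  eapply Rle_trans; [apply Cmod_triangle|].
  rewrite Cmod_mult, Cmod_Ci, !Cmod_R; lra.
Qed.

Lemma MVT_bound_01 (f df : R -> R) M :
  (forall t, 0 <= t <= 1 -> is_derive f t (df t)) ->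
  (forall t, 0 <= t <= 1 -> Rabs (df t) <= M) ->
  Rabs (f 1 - f 0) <= M.
Proof.
  intros Hd HM.
  destruct (MVT_gen f 0 1 df) as [c [Hc E]];
    rewrite Rmin_left, Rmax_right in * by lra.
  - intros t Ht; apply Hd; lra.
  - intros t Ht; apply derivable_continuous_pt.
    exists (df t); apply is_derive_Reals, Hd, Ht.
  - rewrite E, Rminus_0_r, Rmult_1_r; apply HM, Hc.
Qed.

(** The two components are bounded separately. The resulting factor 2 is harmless, since [M] tends
    to 0 in the applications. *)
Lemma Cder_bound_01 (f df : R -> C) M :
  (forall t, 0 <= t <= 1 -> Cder f t (df t)) ->
  (forall t, 0 <= t <= 1 -> Cmod (df t) <= M) ->
  Cmod (f 1 - f 0) <= 2 * M.
Proof.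
  intros Hd HM.
  eapply Rle_trans; [apply Cmod_le_Rabs|].
  replace (2 * M) with (M + M) by ring; apply Rplus_le_compat.
  - apply (MVT_bound_01 (fun t => Re (f t)) (fun t => Re (df t))).
    + intros t Ht; apply (Hd t Ht).
    + intros t Ht; eapply Rle_trans; [apply re_le_Cmod | apply HM, Ht].
  - apply (MVT_bound_01 (fun t => Im (f t)) (fun t => Im (df t))).
    + intros t Ht; apply (Hd t Ht).
    + intros t Ht; eapply Rle_trans; [apply im_le_Cmod | apply HM, Ht].
Qed.

(** * Principal logarithm and principal square root *)

Lemma is_derive_locally_pos (g : R -> R) t d :
  is_derive g t d -> 0 < g t -> locally t (fun s => 0 < g s).
Proof.
  intros H Hp.
  assert (Hc : continuous g t)
    by (apply @ex_derive_continuous; exists d; exact H).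
  exact (Hc _ (open_gt 0 (g t) Hp)).
Qed.

(** A single formula for the open upper half-plane, smooth across the imaginary axis, where the
    definition of [Carg] changes case. *)
Lemma Carg_pos_im (q : C) : 0 < Im q -> Carg q = PI / 2 - atan (Re q / Im q).
Proof.
  intros Hy; unfold Carg.
  destruct (Rlt_dec 0 (Re q)) as [Hx|Hx].
  - replace (Im q / Re q) with (/ (Re q / Im q)) by (field; lra).
    apply atan_inv, Rdiv_lt_0_compat; lra.
  - destruct (Rlt_dec (Re q) 0) as [Hx'|Hx'].
    + destruct (Rle_dec 0 (Im q)); [|lra].
      replace (Im q / Re q) with (- / (- Re q / Im q)) by (field; lra).
      replace (Re q / Im q) with (- (- Re q / Im q)) by (field; lra).
      rewrite !atan_opp, atan_inv; [field | apply Rdiv_lt_0_compat; lra].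
    + destruct (Rlt_dec 0 (Im q)); [|lra].
      replace (Re q) with 0 by lra.
      unfold Rdiv at 3; rewrite Rmult_0_l, atan_0; ring.
Qed.

Lemma Carg_neg_im (q : C) : Im q < 0 -> Carg q = - (PI / 2) - atan (Re q / Im q).
Proof.
  intros Hy; unfold Carg.
  destruct (Rlt_dec 0 (Re q)) as [Hx|Hx].
  - replace (Im q / Re q) with (- / (Re q / - Im q)) by (field; lra).
    replace (Re q / Im q) with (- (Re q / - Im q)) by (field; lra).
    rewrite !atan_opp, atan_inv; [field | apply Rdiv_lt_0_compat; lra].
  - destruct (Rlt_dec (Re q) 0) as [Hx'|Hx'].
    + destruct (Rle_dec 0 (Im q)); [lra|].
      replace (Im q / Re q) with (/ (Re q / Im q)) by (field; lra).
      rewrite atan_inv; [field |].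
      replace (Re q / Im q) with (- Re q / - Im q) by (field; lra).
      apply Rdiv_lt_0_compat; lra.
    + destruct (Rlt_dec 0 (Im q)); [lra|].
      destruct (Rlt_dec (Im q) 0); [|lra].
      replace (Re q) with 0 by lra.
      unfold Rdiv at 3; rewrite Rmult_0_l, atan_0; ring.
Qed.

Lemma is_derive_atan_div (f g : R -> R) t df dg :
  is_derive f t df -> is_derive g t dg -> g t <> 0 ->
  is_derive (fun s => atan (f s / g s)) t
    ((df * g t - f t * dg) / (f t * f t + g t * g t)).
Proof.
  intros Hf Hg Hn.
  assert (0 < g t * g t) by exact (Rsqr_pos_lt _ Hn).
  evar_last.
  - apply (is_derive_comp atan (fun s => f s / g s)).
    + apply is_derive_atan.
    + apply (is_derive_div _ _ _ _ _ Hf Hg Hn).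
  - cbv [scal]; simpl; cbv [mult]; simpl; unfold Rsqr.
    field; repeat split; nra.
Qed.

Lemma is_derive_ln_sqrt_sumsq (f g : R -> R) t df dg :
  is_derive f t df -> is_derive g t dg -> 0 < f t * f t + g t * g t ->
  is_derive (fun s => ln (sqrt (f s * f s + g s * g s))) t
    ((df * f t + dg * g t) / (f t * f t + g t * g t)).
Proof.
  intros Hf Hg Hn.
  assert (Hs := sqrt_lt_R0 _ Hn).
  assert (Hss := sqrt_sqrt _ (Rlt_le _ _ Hn)).
  evar_last.
  - apply (is_derive_comp ln (fun s => sqrt (f s * f s + g s * g s))).
    + apply is_derive_ln, Hs.
    + apply (is_derive_sqrt (fun s => f s * f s + g s * g s)); [|exact Hn].
      apply (is_derive_plus (fun s => f s * f s) (fun s => g s * g s));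
        apply is_derive_Rmult; eassumption.
  - cbv [scal plus]; simpl; cbv [mult]; simpl.
    set (r := sqrt _) in *; rewrite <- Hss; field; lra.
Qed.

(** The hypothesis keeps [q t] off the cut (-oo, 0]. The slit plane is covered by the right, upper
    and lower open half-planes, and on each of them [Carg] is one smooth arctangent formula. *)
Lemma Cder_Clog (q : R -> C) t d :
  Cder q t d -> Im (q t) <> 0 \/ 0 < Re (q t) -> Cder (fun s => Clog (q s)) t (d / q t)%C.
Proof.
  intros [Hx Hy] Hq.
  assert (Hn : 0 < Re (q t) * Re (q t) + Im (q t) * Im (q t)).
  { destruct Hq as [H|H]; [pose proof (Rsqr_pos_lt _ H); unfold Rsqr in *|]; nra. }
  assert (E : (d / q t)%C =
     ((Re d * Re (q t) + Im d * Im (q t)) / (Re (q t) * Re (q t) + Im (q t) * Im (q t)),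
      (Im d * Re (q t) - Im (q t) * Re d) / (Im (q t) * Im (q t) + Re (q t) * Re (q t)))).
  { destruct (q t) as [a b], d as [d1 d2]; simpl in *.
    apply C_ext; simpl; field; lra. }
  rewrite E; split; simpl.
  - apply (is_derive_ext
      (fun s => ln (sqrt (Re (q s) * Re (q s) + Im (q s) * Im (q s))))).
    { intros s; unfold Cmod, Re, Im; f_equal; f_equal; ring. }
    apply (is_derive_ln_sqrt_sumsq _ _ _ _ _ Hx Hy Hn).
  - destruct (Rlt_dec 0 (Re (q t))) as [Px|Px];
      [|destruct (Rlt_dec 0 (Im (q t))) as [Py|Py]].
    + apply (is_derive_ext_loc (fun s => atan (Im (q s) / Re (q s)))).
      * eapply filter_imp; [| exact (is_derive_locally_pos _ _ _ Hx Px)].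
        intros s Hs; unfold Carg.
        destruct (Rlt_dec 0 (Re (q s))); [reflexivity | contradiction].
      * apply (is_derive_atan_div _ _ _ _ _ Hy Hx); lra.
    + apply (is_derive_ext_loc (fun s => PI / 2 - atan (Re (q s) / Im (q s)))).
      * eapply filter_imp; [| exact (is_derive_locally_pos _ _ _ Hy Py)].
        intros s Hs; symmetry; apply Carg_pos_im, Hs.
      * evar_last.
        -- apply (is_derive_minus (fun _ => PI / 2)); [apply @is_derive_const|].
           apply (is_derive_atan_div _ _ _ _ _ Hx Hy); lra.
        -- cbv [minus plus opp zero]; simpl; field; lra.
    + assert (Py' : 0 < - Im (q t)) by (destruct Hq; lra).
      assert (Hy' : is_derive (fun s => - Im (q s)) t (- Im d))
        by exact (is_derive_opp _ _ _ Hy).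
      apply (is_derive_ext_loc (fun s => - (PI / 2) - atan (Re (q s) / Im (q s)))).
      * eapply filter_imp; [| exact (is_derive_locally_pos _ _ _ Hy' Py')].
        intros s Hs; symmetry; apply Carg_neg_im; lra.
      * evar_last.
        -- apply (is_derive_minus (fun _ => - (PI / 2))); [apply @is_derive_const|].
           apply (is_derive_atan_div _ _ _ _ _ Hx Hy); lra.
        -- cbv [minus plus opp zero]; simpl; field; lra.
Qed.

(** The squares of the two radicals differ by Re u, their product is |Im u| / 2, and the sign in
    [Csqrt] turns |Im u| into Im u. *)
Lemma Csqrt_sqr (u : C) : (Csqrt u * Csqrt u)%C = u.
Proof.
  assert (H := re_le_Cmod u); apply Rabs_le_between in H.
  assert (E := Cmod2_alt u).
  unfold Csqrt; apply C_ext; simpl.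
  - set (r := sqrt ((Cmod u + _) / _)); set (p := sqrt ((Cmod u - _) / _)).
    assert (r * r = (Cmod u + Re u) / 2) by (apply sqrt_sqrt; lra).
    assert (p * p = (Cmod u - Re u) / 2) by (apply sqrt_sqrt; lra).
    destruct (Rle_dec 0 (Im u)); nra.
  - assert (P : sqrt ((Cmod u + Re u) / 2) * sqrt ((Cmod u - Re u) / 2) = Rabs (Im u) / 2).
    { rewrite <- sqrt_mult by lra.
      replace ((Cmod u + Re u) / 2 * ((Cmod u - Re u) / 2)) with (Rsqr (Im u / 2))
        by (unfold Rsqr; nra).
      rewrite sqrt_Rsqr_abs, Rabs_div, (Rabs_right 2) by lra; reflexivity. }
    set (r := sqrt ((Cmod u + _) / _)) in *; set (p := sqrt ((Cmod u - _) / _)) in *.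
    destruct (Rle_dec 0 (Im u)).
    + rewrite Rabs_right in P by lra; lra.
    + rewrite Rabs_left in P by lra; lra.
Qed.

(** The quantity |u| + Re u vanishes only on the cut (-oo, 0]. *)
Lemma Csqrt_Re_pos (u : C) : Im u <> 0 \/ 0 < Re u -> 0 < Re (Csqrt u).
Proof.
  intros Hu; apply sqrt_lt_R0.
  assert (E := Cmod2_alt u); assert (Hc := Cmod_ge_0 u).
  apply Rdiv_lt_0_compat; [|lra].
  destruct Hu as [Hu|Hu]; [|lra].
  apply Rnot_le_lt; intros Hl.
  assert (Hp := Rsqr_pos_lt _ Hu); unfold Rsqr in Hp; nra.
Qed.

(** * Complex series *)

Lemma sum_n_CO (f : nat -> C) : sum_n f 0 = f 0%nat.
Proof. apply (sum_O f). Qed.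

Lemma sum_n_Cext (f g : nat -> C) n :
  (forall k, (k <= n)%nat -> f k = g k) -> sum_n f n = sum_n g n.
Proof. apply (sum_n_ext_loc f g n). Qed.

Lemma sum_n_Cscal (c : C) (f : nat -> C) n :
  sum_n (fun k => c * f k)%C n = (c * sum_n f n)%C.
Proof. apply (sum_n_mult_l (K := C_Ring) c f n). Qed.

Lemma Cmod_lt_is_series (a : nat -> C) (l : C) :
  (forall eps, 0 < eps -> exists N, forall n, (N <= n)%nat -> Cmod (sum_n a n - l) < eps) ->
  is_series a l.
Proof.
  intros H; apply filterlim_locally_ball_norm; intros eps.
  destruct (H eps (cond_pos eps)) as [N HN].
  exists N; intros n Hn; exact (HN n Hn).
Qed.

Lemma is_series_Cmod_lt (a : nat -> C) (l : C) eps :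
  is_series a l -> 0 < eps ->
  exists N, forall n, (N <= n)%nat -> Cmod (sum_n a n - l) < eps.
Proof.
  intros H He.
  destruct (proj1 (filterlim_locally_ball_norm _ _) H (mkposreal eps He)) as [N HN].
  exists N; intros n Hn; exact (HN n Hn).
Qed.

Lemma Cmod_le_is_series (a : nat -> C) (l : C) (b : nat -> R) :
  is_lim_seq b 0 -> (forall n, Cmod (sum_n a n - l) <= b n) -> is_series a l.
Proof.
  intros Hb H; apply Cmod_lt_is_series; intros eps He.
  destruct (proj2 (is_lim_seq_spec b 0) Hb (mkposreal eps He)) as [N HN].
  exists N; intros n Hn.
  specialize (HN n Hn); simpl in HN; rewrite Rminus_0_r in HN.
  eapply Rle_lt_trans; [apply H|].
  eapply Rle_lt_trans; [apply Rle_abs | exact HN].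
Qed.

(** * Expansion of the arctangent *)

(* [arctan_moment k t] is the integral of [(2 s^2)^k / (1 + s^2)^(k+1)] over [[0, t]], computed by
   integration by parts. *)
Fixpoint arctan_moment (k : nat) (t : R) : R :=
  match k with
  | O => atan t
  | S k' => ((2 * INR k' + 1) * arctan_moment k' t
             - 2 ^ k' * t ^ (2 * k' + 1) / (1 + t ^ 2) ^ (k' + 1)) / (INR k' + 1)
  end.

Lemma is_derive_arctan_moment k t :
  is_derive (arctan_moment k) t ((2 * t ^ 2) ^ k / (1 + t ^ 2) ^ (k + 1)).
Proof.
  assert (Ht : 0 < 1 + t ^ 2) by nra.
  induction k as [|k IH]; simpl arctan_moment.
  - evar_last; [apply is_derive_atan|]. unfold Rsqr; simpl; field; nra.
  - assert (Hk : INR k + 1 <> 0) by (pose proof (pos_INR k); lra).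
    assert (Hp : (1 + t ^ 2) ^ k <> 0) by (apply pow_nonzero; lra).
    evar_last.
    + apply (is_derive_ext (fun s => / (INR k + 1) * ((2 * INR k + 1) * arctan_moment k s
             - 2 ^ k * s ^ (2 * k + 1) / (1 + s ^ 2) ^ (k + 1)))).
      { intros s; unfold Rdiv; apply Rmult_comm. }
      apply (is_derive_scal _ _ (/ (INR k + 1))).
      apply (is_derive_minus (fun s => (2 * INR k + 1) * arctan_moment k s)).
      * apply (is_derive_scal _ _ (2 * INR k + 1)), IH.
      (* In the derivative of the boundary term, the part with [2 * INR k + 1] cancels the previous
         integrand; the other part is, up to sign, [INR k + 1] times the next one. *)
      * assert (D : is_derive (fun s => 2 ^ k * s ^ (2 * k + 1) / (1 + s ^ 2) ^ (k + 1)) t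
          (2 ^ k * ((2 * INR k + 1) * t ^ (2 * k) * (1 + t ^ 2)
                    - 2 * (INR k + 1) * t ^ (2 * k + 2)) / (1 + t ^ 2) ^ (k + 2))).
        { auto_derive.
          - rewrite Nat.add_comm; simpl pow in *.
            apply Rmult_integral_contrapositive_currified; [lra | exact Hp].
          - rewrite !Nat.add_1_r, ?Nat.pred_succ, !S_INR, ?mult_INR.
            replace (2 * k + 2)%nat with (S (S (2 * k))) by lia.
            replace (k + 2)%nat with (S (S k)) by lia.
            simpl (INR 2). rewrite <- !tech_pow_Rmult.
            replace (1 + t * (t * 1)) with (1 + t ^ 2) by ring.
            change (k + (k + 0))%nat with (2 * k)%nat; rewrite mult_INR.
            change (INR 2) with (1 + 1); change (t ^ 0) with 1.
            change (t * (t * 1)) with (t ^ 2); set (P := (1 + t ^ 2) ^ k) in *.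
            field; split; [exact Hp | nra]. }
        exact D.
    + cbv [scal minus plus opp]; simpl; cbv [mult]; simpl.
      rewrite Nat.add_0_r.
      replace (k + 2)%nat with (S (S k)) by lia.
      replace (k + 1)%nat with (S k) by lia.
      replace (k + k + 2)%nat with (S (S (k + k))) by lia.
      rewrite !Rpow_mult_distr, !pow_add, <- !tech_pow_Rmult, pow_add.
      simpl in Hp. rewrite !Rmult_1_r in *.
      rewrite pow1.
      field. repeat split; auto; nra.
Qed.

Lemma arctan_moment_0 k : arctan_moment k 0 = 0.
Proof.
  induction k as [|k IH]; simpl arctan_moment; [apply atan_0|].
  rewrite IH, pow_i by lia; unfold Rdiv; ring.
Qed.

(** On [0, 1] one has 2 t^2 <= 1 + t^2, so the integrand is at most 1. *)
Lemma arctan_moment_1_bound k : Rabs (arctan_moment k 1) <= 1.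
Proof.
  rewrite <- (Rminus_0_r (arctan_moment k 1)), <- (arctan_moment_0 k).
  apply (MVT_bound_01 _ (fun t => (2 * t ^ 2) ^ k / (1 + t ^ 2) ^ (k + 1))).
  - intros t _; apply is_derive_arctan_moment.
  - intros t Ht.
    assert (0 < (1 + t ^ 2) ^ k) by (apply pow_lt; nra).
    assert ((2 * t ^ 2) ^ k <= (1 + t ^ 2) ^ k) by (apply pow_incr; nra).
    assert (0 <= (2 * t ^ 2) ^ k) by (apply pow_le; nra).
    assert (1 <= 1 + t ^ 2) by nra.
    rewrite pow_add, pow_1.
    rewrite Rabs_right.
    + apply Rle_div_l; nra.
    + apply Rle_ge, Rdiv_le_0_compat; nra.
Qed.

Lemma Cgeom_sum (q : C) N : ((1 - q) * sum_n (fun k => q ^ k) N = 1 - q ^ (S N))%C.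
Proof.
  induction N as [|N IH]; [rewrite sum_n_CO; simpl; ring|].
  rewrite sum_n_CS, Cmult_plus_distr_l, IH; simpl; ring.
Qed.

Lemma Cder_Carctan_ray (w : C) (t : R) : 0 < Re w -> 0 <= t ->
  Cder (fun s => Carctan (w * RtoC s)) t (w / (1 + w * w * RtoC (t ^ 2)))%C.
Proof.
  intros Hw Ht.
  assert (Hl : forall c : C, Cder (fun s => 1 + c * RtoC s)%C t c).
  { intros c; eapply Cder_eq.
    - apply Cder_plus; [apply Cder_const|]; apply Cder_scal, Cder_RtoC.
      apply @is_derive_id.
    - cbv [one]; simpl; ring. }
  (* At t = 0 the point is 1; elsewhere its imaginary part t Im c is nonzero. It is applied to i w
     and - i w, whose imaginary parts are Re w and - Re w. *)
  assert (Hcut : forall c : C, Im c <> 0 ->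
     Im (1 + c * RtoC t)%C <> 0 \/ 0 < Re (1 + c * RtoC t)%C).
  { intros c Hc; destruct (Req_dec t 0) as [->|H0].
    - right; simpl; lra.
    - left; simpl. rewrite Rmult_0_r, !Rplus_0_l.
      apply Rmult_integral_contrapositive_currified; assumption. }
  assert (Hnz : forall q : C, Im q <> 0 \/ 0 < Re q -> q <> 0%C).
  { intros q [H|H] ->; simpl in H; lra. }
  pose (c := (Ci * w)%C).
  assert (Hw' : w = (- Ci * c)%C).
  { unfold c; rewrite Cmult_assoc.
    replace (- Ci * Ci)%C with (RtoC 1) by (apply C_ext; simpl; ring); ring. }
  assert (H2 : Im c <> 0) by (unfold c, Re, Im in *; simpl; lra).
  assert (H1 : Im (- c)%C <> 0) by (unfold Re, Im in *; simpl; lra).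
  assert (N1 := Hnz _ (Hcut _ H1)); assert (N2 := Hnz _ (Hcut _ H2)).
  eapply Cder_eq.
  - apply (Cder_ext_loc (fun s => Ci / 2 * (Clog (1 + - c * RtoC s) - Clog (1 + c * RtoC s)))%C).
    { apply filter_forall; intros s; unfold Carctan, c.
      f_equal; f_equal; [| f_equal]; f_equal; ring. }
    apply Cder_scal, Cder_minus; apply Cder_Clog; auto.
  - assert (E : (1 + w * w * RtoC (t ^ 2) = (1 + - c * RtoC t) * (1 + c * RtoC t))%C).
    { rewrite Hw', RtoC_pow.
      replace (- Ci * c * (- Ci * c))%C with (Ci * Ci * (c * c))%C by ring.
      replace (Ci * Ci)%C with (- (1))%C by (apply C_ext; simpl; ring); simpl; ring. }
    rewrite E, Hw'; field; split; assumption.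
Qed.

Lemma is_lim_seq_scal_pow c q : Rabs q < 1 -> is_lim_seq (fun n => c * q ^ S n) 0.
Proof.
  intros Hq; replace (Finite 0) with (Rbar_mult c 0) by (simpl; f_equal; ring).
  apply is_lim_seq_scal_l; apply -> is_lim_seq_incr_1; apply is_lim_seq_geom, Hq.
Qed.

(** Let q = -2 x t^2 / (1 + t^2), so that 1 + w^2 t^2 = (1 + t^2) (1 - q). The remainder [f] after N
    + 1 terms vanishes at 0 and, by the finite geometric sum, has derivative q^(N+1) / ((1 + t^2) (1
    - q)). Since |q| <= |x| on [0, 1], this is at most |x|^(N+1) / (1 - |x|). *)
Lemma is_series_Carctan_div (x w : C) :
  Cmod x < 1 -> 0 < Re w -> (w * w = 1 + 2 * x)%C ->
  is_series (fun k => (- x) ^ k * RtoC (arctan_moment k 1))%C (Carctan w / w)%C.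
Proof.
  intros Hx Hw Hu.
  assert (Hw0 : w <> 0%C) by (intros ->; simpl in Hw; lra).
  assert (Hx0 := Cmod_ge_0 x).
  apply (Cmod_le_is_series _ _ (fun N => 2 / (1 - Cmod x) * Cmod x ^ S N)).
  { apply is_lim_seq_scal_pow; rewrite Rabs_right; lra. }
  intros N.
  set (f := fun s => (/ w * Carctan (w * RtoC s)
                - sum_n (fun k => (- x) ^ k * RtoC (arctan_moment k s)) N)%C).
  assert (Hf0 : f 0 = 0%C).
  { unfold f, Carctan; rewrite Cmult_0_r.
    rewrite (sum_n_Cext _ (fun _ => 0 * 0)%C), sum_n_Cscal.
    - replace (1 - Ci * 0)%C with (1 + Ci * 0)%C by ring; ring.
    - intros k _; rewrite arctan_moment_0; ring. }
  replace (Cmod _) with (Cmod (f 1 - f 0)).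
  2: { rewrite Hf0, <- Cmod_opp; f_equal; unfold f, Cdiv; rewrite Cmult_1_r; ring. }
  replace (2 / (1 - Cmod x) * Cmod x ^ S N) with (2 * (Cmod x ^ S N / (1 - Cmod x)))
    by (field; lra).
  set (r := fun t => 2 * t ^ 2 / (1 + t ^ 2)).
  set (q := fun t => (- x * RtoC (r t))%C).
  assert (Ht : forall t, 0 < 1 + t ^ 2) by (intros t; nra).
  assert (Hq : forall t, 0 <= t <= 1 -> Cmod (q t) <= Cmod x).
  { intros t H; unfold q; rewrite Cmod_mult, Cmod_opp, Cmod_R.
    assert (0 <= r t) by (apply Rdiv_le_0_compat; [nra | apply Ht]).
    assert (r t <= 1) by (apply Rle_div_l; [apply Ht | nra]).
    rewrite Rabs_right by lra; nra. }
  assert (Hq1 : forall t, 0 <= t <= 1 -> 1 - Cmod x <= Cmod (1 - q t)).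
  { intros t H; specialize (Hq t H).
    pose proof (Cmod_triangle (1 - q t) (q t)) as T.
    replace (1 - q t + q t)%C with (RtoC 1) in T by ring.
    rewrite Cmod_1 in T; lra. }
  apply (Cder_bound_01 f (fun t => q t ^ S N / (RtoC (1 + t ^ 2) * (1 - q t)))%C).
  - intros t H.
    assert (Hn1 : (1 - q t)%C <> 0%C)
      by (apply Cmod_gt_0; specialize (Hq1 t H); lra).
    assert (Hn2 : RtoC (1 + t ^ 2) <> 0%C)
      by (intros E; apply RtoC_inj in E; specialize (Ht t); lra).
    eapply Cder_eq.
    + apply Cder_minus.
      * apply Cder_scal, (Cder_Carctan_ray w t Hw); apply H.
      * apply (Cder_sum_n (fun k s => (- x) ^ k * RtoC (arctan_moment k s))%C).
        intros k; apply Cder_scal, Cder_RtoC, is_derive_arctan_moment.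
    + rewrite (sum_n_Cext _ (fun k => / RtoC (1 + t ^ 2) * q t ^ k)%C).
      * rewrite sum_n_Cscal.
        assert (E : (1 + w * w * RtoC (t ^ 2) = RtoC (1 + t ^ 2) * (1 - q t))%C).
        { rewrite Hu; unfold q, r; rewrite RtoC_div, RtoC_plus, RtoC_mult
            by (specialize (Ht t); lra).
          rewrite RtoC_plus in Hn2; field; exact Hn2. }
        rewrite E; pose proof (Cgeom_sum (q t) N) as G.
        set (s := sum_n _ _) in *.
        replace (q t ^ S N)%C with (1 - (1 - q t) * s)%C by (rewrite G; ring).
        field; auto.
      * intros k _; unfold q.
        rewrite Cpow_mult_l, <- RtoC_pow, Cmult_assoc, (Cmult_comm (/ _)), <- Cmult_assoc.
        f_equal. rewrite <- RtoC_inv, <- RtoC_mult by (specialize (Ht t); lra).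
        f_equal; unfold r, Rdiv; rewrite !Rpow_mult_distr, pow_add, pow_inv.
        field; repeat split; try apply pow_nonzero; specialize (Ht t); lra.
  - intros t H; specialize (Hq t H); specialize (Hq1 t H).
    assert (Hp := pow_le _ (S N) Hx0).
    rewrite Cmod_div, Cmod_mult, Cmod_R, Cmod_pow, Rabs_right.
    2: specialize (Ht t); lra.
    2: { apply Cmod_gt_0; rewrite Cmod_mult, Cmod_R, Rabs_right by (specialize (Ht t); lra).
         apply Rmult_lt_0_compat; [apply Ht | lra]. }
    apply Rmult_le_compat.
    + apply pow_le, Cmod_ge_0.
    + apply Rlt_le, Rinv_0_lt_compat, Rmult_lt_0_compat; [apply Ht | lra].
    + apply pow_incr; split; [apply Cmod_ge_0 | exact Hq].
    + apply Rinv_le_contravar; [lra | nra].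
Qed.

(** * The complex exponential *)

Lemma exp_le_compat (x y : R) : x <= y -> exp x <= exp y.
Proof. intros [H|H]; [left; apply exp_increasing, H | right; rewrite H; reflexivity]. Qed.

Lemma Cexp_plus (a b : C) : Cexp (a + b) = (Cexp a * Cexp b)%C.
Proof.
  destruct a, b; unfold Cexp; apply C_ext; simpl; rewrite exp_plus, ?cos_plus, ?sin_plus; ring.
Qed.

Lemma Cexp_0 : Cexp 0 = 1%C.
Proof. unfold Cexp; simpl; rewrite exp_0, cos_0, sin_0; apply C_ext; simpl; ring. Qed.

Lemma Cexp_RtoC (r : R) : Cexp (RtoC r) = RtoC (exp r).
Proof. unfold Cexp; simpl; rewrite cos_0, sin_0; apply C_ext; simpl; ring. Qed.

Lemma Cexp_INR_mult (y : C) (j : nat) : Cexp (INR j * y) = (Cexp y ^ j)%C.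
Proof.
  induction j as [|j IH]; [rewrite Cmult_0_l; apply Cexp_0|].
  rewrite S_INR, RtoC_plus, Cmult_plus_distr_r, Cmult_1_l, Cexp_plus, IH; simpl; ring.
Qed.

Lemma Cmod_Cexp (z : C) : Cmod (Cexp z) = exp (Re z).
Proof.
  assert (H := exp_pos (Re z)).
  unfold Cmod, Cexp; simpl fst; simpl snd.
  replace (_ + _) with (Rsqr (exp (Re z)) * (Rsqr (sin (Im z)) + Rsqr (cos (Im z))))
    by (unfold Rsqr; ring).
  rewrite sin2_cos2, Rmult_1_r; apply sqrt_Rsqr; lra.
Qed.

Lemma Cder_Cexp_ray (c : C) (t : R) :
  Cder (fun s => Cexp (c * RtoC s)) t (c * Cexp (c * RtoC t))%C.
Proof.
  destruct c as [a b]; unfold Cexp; split; simpl;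
    (auto_derive; [trivial | unfold Rminus; ring]).
Qed.

Definition Cexp_term (z : C) (n : nat) : C := (z ^ n * RtoC (/ INR (fact n)))%C.

Lemma is_lim_seq_pow_fact (r : R) : is_lim_seq (fun n => r ^ n / INR (fact n)) 0.
Proof.
  apply ex_series_lim_0; exists (exp r).
  refine (is_series_ext _ _ _ _ (is_exp_Reals r)).
  intros n; rewrite pow_n_pow; reflexivity.
Qed.

(* [Cexp (- z t)] times the [N]-th Taylor polynomial of [Cexp (z t)] has derivative
   [- z (z t)^N / N! * Cexp (- z t)] in [t]. *)
Lemma is_series_Cexp (z : C) : is_series (Cexp_term z) (Cexp z).
Proof.
  set (f := fun N s => (Cexp (- z * RtoC s) * sum_n (fun n => Cexp_term z n * RtoC (s ^ n)) N)%C).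
  set (df := fun N s => (- z * (Cexp_term z N * RtoC (s ^ N)) * Cexp (- z * RtoC s))%C).
  assert (Hp : forall t n, Cder (fun s => Cexp_term z n * RtoC (s ^ n))%C t
     (match n with O => 0 | S m => z * (Cexp_term z m * RtoC (t ^ m)) end)%C).
  { intros t n; eapply Cder_eq.
    - apply Cder_scal, Cder_RtoC, is_derive_Reals, derivable_pt_lim_pow.
    - destruct n as [|m].
      + simpl; rewrite !Rmult_0_l; ring.
      + unfold Cexp_term; simpl pred.
        assert (E : RtoC (/ INR (fact m)) = (RtoC (/ INR (fact (S m))) * RtoC (INR (S m)))%C).
        { rewrite <- RtoC_mult; f_equal.
          change (fact (S m)) with (S m * fact m)%nat; rewrite mult_INR.
          field; split; [apply INR_fact_neq_0 | apply not_0_INR; lia]. }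
        rewrite E, !RtoC_mult, Cpow_S; ring. }
  assert (Hd : forall N t, Cder (f N) t (df N t)).
  { intros N t; eapply Cder_eq.
    - apply Cder_mult; [apply Cder_Cexp_ray|].
      apply (Cder_sum_n (fun n s => Cexp_term z n * RtoC (s ^ n))%C).
      intros n; apply Hp.
    - unfold df; generalize (Cexp (- z * RtoC t)); intros e.
      induction N as [|N IH].
      + rewrite !sum_n_CO; ring.
      + rewrite !sum_n_CS, !Cmult_plus_distr_l.
        match goal with |- (?a + ?b + (?d + ?g) = _)%C =>
          transitivity ((a + d) + (b + g))%C; [ring | rewrite IH; ring] end. }
  assert (Hm := Cmod_ge_0 z); assert (He := exp_pos (Cmod z)).
  (* One factor exp |z| bounds |e^z|, the other |e^(-zt)|; the 2 comes from [Cder_bound_01]. *)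
  set (K := 2 * (exp (Cmod z) * exp (Cmod z) * Cmod z)).
  apply (Cmod_le_is_series _ _ (fun N => K * (Cmod z ^ N / INR (fact N)))).
  { replace (Finite 0) with (Rbar_mult K 0) by (simpl; f_equal; ring).
    apply is_lim_seq_scal_l, is_lim_seq_pow_fact. }
  intros N.
  assert (F0 : f N 0 = 1%C).
  { unfold f; rewrite Cmult_0_r, Cexp_0, Cmult_1_l.
    induction N as [|N IH]; [rewrite sum_n_CO; unfold Cexp_term; simpl; rewrite Rinv_1; ring|].
    rewrite sum_n_CS, IH, pow_i by lia; ring. }
  (* Multiplying by e^z undoes the factor e^(-z) in [f N 1], so the truncation error is e^z times an
     increment of [f N]. *)
  assert (F1 : (sum_n (Cexp_term z) N - Cexp z = Cexp z * (f N 1%R - f N 0%R))%C).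
  { rewrite F0; unfold f; rewrite Cmult_1_r.
    rewrite (sum_n_Cext (fun n => Cexp_term z n * RtoC (1 ^ n))%C (Cexp_term z))
      by (intros; rewrite pow1; ring).
    transitivity (Cexp (z + - z) * sum_n (Cexp_term z) N - Cexp z)%C.
    - rewrite Cplus_opp_r, Cexp_0; ring.
    - rewrite Cexp_plus; ring. }
  rewrite F1, Cmod_mult.
  assert (B : Cmod (f N 1 - f N 0)
     <= 2 * (exp (Cmod z) * Cmod z * (Cmod z ^ N / INR (fact N)))).
  { apply (Cder_bound_01 _ (df N)); [intros; apply Hd|].
    intros t Ht; unfold df, Cexp_term.
    assert (Hf := INR_fact_lt_0 N).
    assert (Hre := re_le_Cmod z); apply Rabs_le_between in Hre.
    rewrite !Cmod_mult, !Cmod_R, Cmod_pow, Cmod_opp, Cmod_Cexp.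
    rewrite (Rabs_right (/ _)) by (left; apply Rinv_0_lt_compat, Hf).
    rewrite <- RPow_abs, (Rabs_right t) by lra.
    assert (E : exp (Re (- z * RtoC t)%C) <= exp (Cmod z)).
    { apply exp_le_compat; unfold Re in *; simpl; rewrite Rmult_0_r. nra. }
    assert (T : 0 <= t ^ N <= 1).
    { split; [apply pow_le; lra|]. rewrite <- (pow1 N); apply pow_incr; lra. }
    assert (P : 0 <= Cmod z * (Cmod z ^ N / INR (fact N))).
    { apply Rmult_le_pos; [exact Hm|]; apply Rdiv_le_0_compat; [apply pow_le, Hm | exact Hf]. }
    assert (E0 := exp_pos (Re (- z * RtoC t)%C)).
    unfold Rdiv in *; set (e := exp (Re _)) in *; set (p := Cmod z * _) in *.
    replace (Cmod z * (Cmod z ^ N * / INR (fact N) * t ^ N) * e) with (p * (t ^ N * e))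
      by (unfold p; ring).
    replace (exp (Cmod z) * Cmod z * (Cmod z ^ N * / INR (fact N))) with (p * exp (Cmod z))
      by (unfold p; ring).
    apply Rmult_le_compat_l; [exact P | nra]. }
  assert (E : Cmod (Cexp z) <= exp (Cmod z)).
  { rewrite Cmod_Cexp; apply exp_le_compat.
    assert (Hre := re_le_Cmod z); apply Rabs_le_between in Hre; lra. }
  unfold K. eapply Rle_trans.
  - apply Rmult_le_compat; [apply Cmod_ge_0 | apply Cmod_ge_0 | exact E | exact B].
  - right; ring.
Qed.

(** * Stirling numbers as finite differences *)

Fixpoint fdiff (k : nat) (f : nat -> C) (j : nat) : C :=
  match k with
  | O => f j
  | S k' => (fdiff k' f (S j) - fdiff k' f j)%C
  end.

Lemma fdiff_ext k f g j : (forall i, f i = g i) -> fdiff k f j = fdiff k g j.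
Proof. intros H; revert j; induction k; intros j; simpl; [apply H | congruence]. Qed.

Lemma fdiff_scal k c f j : fdiff k (fun i => c * f i)%C j = (c * fdiff k f j)%C.
Proof. revert j; induction k as [|k IH]; intros j; simpl; rewrite ?IH; ring. Qed.

Lemma fdiff_pow k (q : C) j : fdiff k (fun i => q ^ i)%C j = ((q - 1) ^ k * q ^ j)%C.
Proof. revert j; induction k as [|k IH]; intros j; simpl; rewrite ?IH; simpl; ring. Qed.

(** The discrete Leibniz rule for a product with the identity: only two terms survive because second
    differences of i |-> i vanish. *)
Lemma fdiff_index_mult k f j :
  fdiff (S k) (fun i => RtoC (INR i) * f i)%C j
  = (RtoC (INR j) * fdiff (S k) f j + RtoC (INR (S k)) * fdiff k f (S j))%C.
Proof.
  revert j; induction k as [|k IH]; intros j.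
  - cbn [fdiff]; rewrite (S_INR j), RtoC_plus; change (INR 1) with 1; ring.
  - change (fdiff (S (S k)) ?h j) with (fdiff (S k) h (S j) - fdiff (S k) h j)%C.
    rewrite !IH.
    change (fdiff (S k) f (S j)) with (fdiff k f (S (S j)) - fdiff k f (S j))%C.
    rewrite (S_INR (S k)), (S_INR j), !RtoC_plus; ring.
Qed.

(** Writing i^(n+1) = i i^n and applying the Leibniz rule at 0, where its first term vanishes, gives
    the recurrence of k! S(n,k). *)
Lemma fdiff_stirling2 n k :
  fdiff k (fun i => RtoC (INR i ^ n)) 0 = RtoC (INR (stirling2 n k * fact k)).
Proof.
  revert k; induction n as [|n IH]; intros k.
  - rewrite (fdiff_ext _ _ (fun i => 1 ^ i)%C), fdiff_pow.
    + destruct k; simpl; ring.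
    + intros i; simpl; induction i as [|i IHi]; [reflexivity|]; simpl; rewrite <- IHi; ring.
  - rewrite (fdiff_ext _ _ (fun i => RtoC (INR i) * RtoC (INR i ^ n))%C)
      by (intros i; rewrite <- RtoC_mult; reflexivity).
    destruct k as [|k]; [simpl; ring|].
    rewrite fdiff_index_mult.
    (* The difference at 1 is moved back to 0, where the induction hypothesis applies. *)
    replace (fdiff k (fun i => RtoC (INR i ^ n)) 1)
      with (fdiff (S k) (fun i => RtoC (INR i ^ n)) 0 + fdiff k (fun i => RtoC (INR i ^ n)) 0)%C
      by (simpl; ring).
    rewrite !IH.
    replace (stirling2 (S n) (S k) * fact (S k))%nat
      with (S k * (stirling2 n (S k) * fact (S k) + stirling2 n k * fact k))%nat
      by (change (fact (S k)) with (S k * fact k)%nat;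
          change (stirling2 (S n) (S k)) with (S k * stirling2 n (S k) + stirling2 n k)%nat; ring).
    rewrite (mult_INR (S k)), plus_INR, RtoC_mult, RtoC_plus; simpl (INR 0); ring.
Qed.

Lemma is_series_fdiff (a : nat -> nat -> C) (L : nat -> C) k j :
  (forall i, is_series (fun n => a n i) (L i)) ->
  is_series (fun n => fdiff k (a n) j) (fdiff k L j).
Proof.
  intros H; revert j; induction k as [|k IH]; intros j; [apply H|].
  exact (is_series_minus _ _ _ _ (IH (S j)) (IH j)).
Qed.

(** Take the k-th difference in j, at 0, of e^(j y) = sum_n j^n y^n / n!, term by term. This ties
    the recursive [stirling2] to the generating function that defines S(n,k). *)
Lemma is_series_stirling2_egf (y : C) k :
  is_series (fun n => Cexp_term y n * RtoC (INR (stirling2 n k * fact k)))%C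
    ((Cexp y - 1) ^ k)%C.
Proof.
  replace ((Cexp y - 1) ^ k)%C with (fdiff k (fun j => Cexp y ^ j)%C 0)
    by (rewrite fdiff_pow; simpl; ring).
  apply (is_series_ext (fun n => fdiff k (fun i => Cexp_term y n * RtoC (INR i ^ n))%C 0)).
  { intros n; rewrite fdiff_scal, fdiff_stirling2; reflexivity. }
  apply (is_series_fdiff (fun n i => Cexp_term y n * RtoC (INR i ^ n))%C).
  intros i; rewrite <- Cexp_INR_mult.
  refine (is_series_ext _ _ _ _ (is_series_Cexp (RtoC (INR i) * y)%C)).
  intros n; change (Cexp_term (RtoC (INR i) * y) n = (Cexp_term y n * RtoC (INR i ^ n))%C);
    unfold Cexp_term; rewrite Cpow_mult_l, RtoC_pow; ring.
Qed.

Lemma sum_n_RtoC (a : nat -> R) n : sum_n (fun k => RtoC (a k)) n = RtoC (sum_n a n).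
Proof.
  induction n as [|n IH]; [rewrite !sum_O; reflexivity|].
  rewrite sum_n_CS, IH, sum_Sn, <- RtoC_plus; reflexivity.
Qed.

Lemma is_series_RtoC_inv (a : nat -> R) (l : R) :
  is_series (fun n => RtoC (a n)) (RtoC l) -> is_series a l.
Proof.
  intros H; change (is_lim_seq (sum_n a) l); apply is_lim_seq_spec; intros eps.
  destruct (is_series_Cmod_lt _ _ _ H (cond_pos eps)) as [N HN].
  exists N; intros n Hn; specialize (HN n Hn).
  rewrite sum_n_RtoC, <- RtoC_minus, Cmod_R in HN; exact HN.
Qed.

(** * Exchange of summations *)

(** The remainder is dominated by the remainder of the series of moduli: compare with a much later
    partial sum and let its error tend to 0. *)
Lemma series_partial_dist (a : nat -> C) (l : C) (q : R) N :
  is_series a l -> is_series (fun n => Cmod (a n)) q ->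
  Cmod (sum_n a N - l) <= q - sum_n (fun n => Cmod (a n)) N.
Proof.
  intros Ha Hq; apply le_epsilon; intros eps He.
  destruct (is_series_Cmod_lt _ _ _ Ha He) as [M HM].
  specialize (HM (N + M)%nat ltac:(lia)).
  assert (HT : forall m, Cmod (sum_n a (N + m) - sum_n a N)
     <= sum_n (fun n => Cmod (a n)) (N + m) - sum_n (fun n => Cmod (a n)) N).
  { intros m; induction m as [|m IH].
    - rewrite Nat.add_0_r; replace (sum_n a N - sum_n a N)%C with (RtoC 0) by ring.
      rewrite Cmod_0; lra.
    - rewrite Nat.add_succ_r, sum_n_CS, sum_Sn.
      replace (sum_n a (N + m) + a (S (N + m)) - sum_n a N)%C
        with (sum_n a (N + m) - sum_n a N + a (S (N + m)))%C by ring.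
      pose proof (Cmod_triangle (sum_n a (N + m) - sum_n a N) (a (S (N + m)))).
      change plus with Rplus; lra. }
  assert (HQ : sum_n (fun n => Cmod (a n)) (N + M) <= q).
  { apply (is_lim_seq_incr_compare _ q Hq); intros n.
    rewrite sum_Sn; change plus with Rplus; pose proof (Cmod_ge_0 (a (S n))); lra. }
  specialize (HT M).
  replace (sum_n a N - l)%C
    with (- (sum_n a (N + M) - sum_n a N) + (sum_n a (N + M) - l))%C by ring.
  eapply Rle_trans; [apply Cmod_triangle|]; rewrite Cmod_opp; lra.
Qed.

Lemma Cmod_sum_n_le (a : nat -> C) (b : nat -> R) N :
  (forall n, (n <= N)%nat -> Cmod (a n) <= b n) -> Cmod (sum_n a N) <= sum_n b N.
Proof.
  intros H; induction N as [|N IH]; [rewrite sum_n_CO, sum_O; apply H; lia|].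
  rewrite sum_n_CS, sum_Sn; eapply Rle_trans; [apply Cmod_triangle|].
  apply Rplus_le_compat; [apply IH; intros; apply H; lia | apply H; lia].
Qed.

Lemma sum_n_minus_C (a b : nat -> C) N :
  sum_n (fun n => a n - b n)%C N = (sum_n a N - sum_n b N)%C :> C.
Proof.
  induction N as [|N IH]; [rewrite !sum_n_CO; reflexivity|].
  rewrite !sum_n_CS, IH; ring.
Qed.

(** The entries with n < k vanish, so the triangle can be completed to a square before switching the
    sums. *)
Lemma sum_n_triangle (p : nat -> nat -> C) N :
  (forall n k, (n < k)%nat -> p n k = 0%C) ->
  sum_n (fun n => sum_n (p n) n) N = sum_n (fun k => sum_n (fun n => p n k) N) N.
Proof.
  intros H; transitivity (sum_n (fun n => sum_n (p n) N) N).
  - apply sum_n_Cext; intros n Hn.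
    replace N with (n + (N - n))%nat by lia; generalize (N - n)%nat; intros m.
    induction m as [|m IH]; [rewrite Nat.add_0_r; reflexivity|].
    rewrite Nat.add_succ_r, sum_n_CS, <- IH, (H n) by lia; symmetry; apply Cplus_0_r.
  - apply (sum_n_switch p N N).
Qed.

Lemma is_lim_seq_sum_n_0 (r : nat -> nat -> R) K :
  (forall k, is_lim_seq (fun N => r N k) 0) -> is_lim_seq (fun N => sum_n (r N) K) 0.
Proof.
  intros H; induction K as [|K IH].
  - apply (is_lim_seq_ext (fun N => r N 0%nat)); [intros; rewrite sum_O; reflexivity | apply H].
  - apply (is_lim_seq_ext (fun N => sum_n (r N) K + r N (S K))).
    + intros; rewrite sum_Sn; reflexivity.
    + replace (Finite 0) with (Finite (0 + 0)) by (f_equal; ring).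
      apply is_lim_seq_plus'; [exact IH | apply H].
Qed.

(* Summing by rows instead of columns; the columns [k <= K] are controlled by their tails
   [r N k], the remaining ones by the tail of [sum Q]. *)
Lemma is_series_triangle (p : nat -> nat -> C) (P : nat -> C) (Q : nat -> R) (L : C) :
  (forall n k, (n < k)%nat -> p n k = 0%C) ->
  (forall k, is_series (fun n => p n k) (P k)) ->
  (forall k, is_series (fun n => Cmod (p n k)) (Q k)) ->
  ex_series Q -> is_series P L ->
  is_series (fun n => sum_n (p n) n) L.
Proof.
  intros H0 HP HQ [q Hq] HL; apply Cmod_lt_is_series; intros eps He.
  assert (He3 : 0 < eps / 3) by lra.
  set (r := fun N k => Q k - sum_n (fun n => Cmod (p n k)) N).
  assert (Hr : forall N k, r N k <= Q k).
  { intros N k; unfold r.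
    assert (0 <= sum_n (fun n => Cmod (p n k)) N); [|lra].
    induction N as [|N IH]; [rewrite sum_O; apply Cmod_ge_0|].
    rewrite sum_Sn; apply Rplus_le_le_0_compat; [exact IH | apply Cmod_ge_0]. }
  assert (HQ0 : forall k, 0 <= Q k).
  { intros k; pose proof (series_partial_dist _ _ _ 0 (HP k) (HQ k)) as D.
    pose proof (Hr 0%nat k); unfold r in *.
    pose proof (Cmod_ge_0 (sum_n (fun n => p n k) 0 - P k)); lra. }
  assert (Hinc : forall n, sum_n Q n <= q).
  { apply (is_lim_seq_incr_compare _ q Hq); intros n.
    rewrite sum_Sn; change plus with Rplus; pose proof (HQ0 (S n)); lra. }
  destruct (proj2 (is_lim_seq_spec (sum_n Q) q) Hq (mkposreal _ He3)) as [K HK].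
  specialize (HK K (le_n K)); simpl in HK; apply Rabs_def2 in HK.
  assert (Hlim : is_lim_seq (fun N => sum_n (r N) K) 0).
  { apply is_lim_seq_sum_n_0; intros k; unfold r.
    replace (Finite 0) with (Finite (Q k - Q k)) by (f_equal; ring).
    apply is_lim_seq_minus'; [apply is_lim_seq_const | apply HQ]. }
  destruct (proj2 (is_lim_seq_spec _ _) Hlim (mkposreal _ He3)) as [N1 HN1].
  destruct (is_series_Cmod_lt _ _ _ HL He3) as [N2 HN2].
  (* Having N >= K allows the columns to be split at K. The three thirds bound the tails of the
     columns up to K, the sum of [Q] past K, and the remainder of the series of [P]. *)
  exists (K + N1 + N2)%nat; intros N HN.
  specialize (HN1 N ltac:(lia)); simpl in HN1; apply Rabs_def2 in HN1.
  specialize (HN2 N ltac:(lia)).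
  rewrite (sum_n_triangle p N H0).
  set (A := sum_n _ N).
  assert (D : Cmod (A - sum_n P N) <= sum_n (r N) N).
  { unfold A; rewrite <- sum_n_minus_C; apply Cmod_sum_n_le; intros k _.
    apply series_partial_dist; auto. }
  assert (T : forall m, sum_n (r N) (K + m) - sum_n (r N) K <= sum_n Q (K + m) - sum_n Q K).
  { intros m; induction m as [|m IH]; [rewrite Nat.add_0_r; lra|].
    rewrite Nat.add_succ_r, !sum_Sn; pose proof (Hr N (S (K + m))).
    change plus with Rplus; lra. }
  specialize (T (N - K)%nat); replace (K + (N - K))%nat with N in T by lia.
  pose proof (Hinc N).
  replace (A - L)%C with ((A - sum_n P N) + (sum_n P N - L))%C by ring.
  eapply Rle_lt_trans; [apply Cmod_triangle|]; lra.
Qed.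

(** * The recurrence for the coefficients *)

(* [sin_seq l = Im ((1 - i)^l)] and [cos_seq l = Re ((1 - i)^l)]. *)
Definition sin_seq (l : nat) : R :=
  (-1) ^ l * Rpower 2 (INR l / 2) * sin (3 * INR l * PI / 4).

Definition cos_seq (l : nat) : R :=
  (-1) ^ l * Rpower 2 (INR l / 2) * cos (3 * INR l * PI / 4).

Lemma Rpower_half_S (l : nat) :
  Rpower 2 (INR (S l) / 2) = sqrt 2 * Rpower 2 (INR l / 2).
Proof.
  rewrite <- (Rpower_sqrt 2), <- Rpower_plus by lra.
  f_equal; rewrite S_INR; field.
Qed.

Lemma sin_seq_S l : sin_seq (S l) = sin_seq l - cos_seq l.
Proof.
  unfold sin_seq, cos_seq; rewrite Rpower_half_S.
  replace (3 * INR (S l) * PI / 4) with (3 * INR l * PI / 4 + 3 * (PI / 4))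
    by (rewrite S_INR; field).
  rewrite sin_plus, sin_3PI4, cos_3PI4; simpl; field; apply Rgt_not_eq, Rlt_sqrt2_0.
Qed.

Lemma cos_seq_S l : cos_seq (S l) = cos_seq l + sin_seq l.
Proof.
  unfold sin_seq, cos_seq; rewrite Rpower_half_S.
  replace (3 * INR (S l) * PI / 4) with (3 * INR l * PI / 4 + 3 * (PI / 4))
    by (rewrite S_INR; field).
  rewrite cos_plus, sin_3PI4, cos_3PI4; simpl; field; apply Rgt_not_eq, Rlt_sqrt2_0.
Qed.

(** The number 1 - i is a root of X^2 - 2 X + 2. *)
Lemma sin_seq_SS l : sin_seq (S (S l)) = 2 * sin_seq (S l) - 2 * sin_seq l.
Proof. rewrite (sin_seq_S (S l)), cos_seq_S, sin_seq_S; ring. Qed.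

Lemma sin_seq_0 : sin_seq 0 = 0.
Proof.
  unfold sin_seq; replace (3 * INR 0 * PI / 4) with 0 by (simpl; field).
  rewrite sin_0; ring.
Qed.

Lemma sin_seq_1 : sin_seq 1 = -1.
Proof.
  rewrite sin_seq_S, sin_seq_0; unfold cos_seq.
  replace (3 * INR 0 * PI / 4) with 0 by (simpl; field).
  replace (INR 0 / 2) with 0 by (simpl; field).
  rewrite cos_0, Rpower_O by lra; simpl; ring.
Qed.

(** * Ballot numbers and the recurrence of the sine sum *)

Lemma sum_n_RS (f : nat -> R) n : sum_n f (S n) = sum_n f n + f (S n).
Proof. apply (sum_Sn f n). Qed.

Lemma sum_n_Rscal (c : R) (f : nat -> R) n :
  sum_n (fun k => c * f k) n = c * sum_n f n.
Proof. apply (sum_n_mult_l (K := R_Ring) c f n). Qed.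

Lemma sum_n_Rplus (f g : nat -> R) n :
  sum_n (fun k => f k + g k) n = sum_n f n + sum_n g n.
Proof. apply (sum_n_plus (G := R_AbelianMonoid) f g n). Qed.

Lemma sum_n_Rext (f g : nat -> R) n :
  (forall k, (k <= n)%nat -> f k = g k) -> sum_n f n = sum_n g n.
Proof. apply (sum_n_ext_loc (G := R_AbelianMonoid) f g n). Qed.

(** For m <= j + 1 this is the coefficient of x^(j+1) in y^m, where y = x + y^2 is x times the
    Catalan series. *)
Definition ballot (j m : nat) : R := INR m / INR (S j) * Binomial.C (2 * j + 1 - m) j.

(** Coefficient of x^(j+2) in x y^m = y^(m+1) - y^(m+2). *)
Lemma ballot_rec j m : (m <= j)%nat ->
  ballot j m = ballot (S j) (S m) - ballot (S j) (S (S m)).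
Proof.
  (* With j = m + i all truncated subtractions disappear, and the binomials become quotients of
     factorials that [field] can compare. *)
  intros Hm; replace j with (m + (j - m))%nat by lia.
  generalize (j - m)%nat; clear j Hm; intros i; unfold ballot, Binomial.C.
  replace (2 * (m + i) + 1 - m)%nat with (S (m + i + i)) by lia.
  replace (2 * S (m + i) + 1 - S m)%nat with (S (S (m + i + i))) by lia.
  replace (2 * S (m + i) + 1 - S (S m))%nat with (S (m + i + i)) by lia.
  replace (S (m + i + i) - (m + i))%nat with (S i) by lia.
  replace (S (S (m + i + i)) - S (m + i))%nat with (S i) by lia.
  replace (S (m + i + i) - S (m + i))%nat with i by lia.
  rewrite !fact_simpl, !mult_INR, !S_INR, !plus_INR.
  pose proof (pos_INR m); pose proof (pos_INR i).
  field; repeat split; try apply INR_fact_neq_0; lra.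
Qed.

Lemma ballot_diag j : ballot j (S j) = 1.
Proof.
  unfold ballot, Binomial.C.
  replace (2 * j + 1 - S j)%nat with j by lia; rewrite Nat.sub_diag; change (INR (fact 0)) with 1.
  field; split; [apply INR_fact_neq_0 | apply not_0_INR; lia].
Qed.

(** The difference is moved from [c] to [r]: the coefficient of c(m+2) becomes 2 r(m+1) - 2 r(m) =
    r(m+2), and that of c(1) is 2 r(0) = r(1). Only the top boundary term remains. *)
Lemma sum_by_parts (r c : nat -> R) M :
  r 1%nat = 2 * r 0%nat -> (forall m, r (S (S m)) = 2 * r (S m) - 2 * r m) -> c 0%nat = 0 ->
  sum_n (fun m => 2 * (r m * (c (S m) - c (S (S m))))) M
  = sum_n (fun m => r m * c m) (S M) - 2 * r M * c (S (S M)) :> R.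
Proof.
  intros H1 H2 H3; induction M as [|M IH].
  - rewrite sum_n_RS, !sum_O, H1, H3; ring.
  - rewrite sum_n_RS, IH, !sum_n_RS, H2; ring.
Qed.

(* In generating functions: [ballot] gives the powers of the solution [y] of [y - y^2 = x], and
   [sum_m sin_seq (m+1) y^m = - 1 / (1 - 2 y + 2 y^2) = - 1 / (1 - 2 x)]. *)
Lemma sum_sin_seq_ballot j :
  sum_n (fun m => sin_seq (S m) * ballot j m) (S j) = - 2 ^ S j :> R.
Proof.
  induction j as [|j IH].
  - rewrite sum_n_RS, sum_O, ballot_diag, (sin_seq_SS 0), sin_seq_1, sin_seq_0.
    unfold ballot; simpl; field.
  - rewrite sum_n_RS, ballot_diag.
    replace (- 2 ^ S (S j)) with (2 * - 2 ^ S j) by (simpl; ring).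
    rewrite <- IH, (sum_n_RS (fun m => sin_seq (S m) * ballot j m) j), ballot_diag.
    rewrite Rmult_plus_distr_l, <- sum_n_Rscal.
    rewrite (sum_n_Rext (fun m => 2 * (sin_seq (S m) * ballot j m))
      (fun m => 2 * (sin_seq (S m) * (ballot (S j) (S m) - ballot (S j) (S (S m))))))
      by (intros m Hm; rewrite ballot_rec by exact Hm; reflexivity).
    rewrite (sum_by_parts (fun m => sin_seq (S m)) (ballot (S j))).
    + rewrite ballot_diag, (sin_seq_SS (S j)); ring.
    + rewrite sin_seq_SS, sin_seq_0; ring.
    + intros m; apply sin_seq_SS.
    + unfold ballot; simpl; field. pose proof (pos_INR j). destruct j; simpl in *; lra.
Qed.

Definition sin_binomial_sum (k : nat) : R :=
  sum_n_m (fun l => (-1) ^ l * Binomial.C (2 * k - l) k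
                     * Rpower 2 (INR l / 2) / INR l * sin (3 * INR l * PI / 4)) 1 k.

Lemma sin_binomial_sum_0 : sin_binomial_sum 0 = 0.
Proof. apply (sum_n_m_zero (G := R_AbelianMonoid)); lia. Qed.

Lemma sin_binomial_sum_S j :
  sin_binomial_sum (S j)
  = sum_n (fun m => sin_seq (S m) / INR (S m) * Binomial.C (2 * j + 1 - m) (S j)) j.
Proof.
  unfold sin_binomial_sum, sum_n.
  rewrite <- (sum_n_m_S (G := R_AbelianMonoid)).
  apply (sum_n_m_ext (G := R_AbelianMonoid)); intros m.
  replace (2 * S j - S m)%nat with (2 * j + 1 - m)%nat by lia.
  match goal with |- ?a = ?b => change (a = b :> R) end.
  unfold sin_seq, Rdiv; ring.
Qed.

(** Termwise form of the recurrence for the sine sum: the defect of the homogeneous relation is a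
    ballot number, so the inhomogeneous term is evaluated by [sum_sin_seq_ballot]. *)
Lemma binomial_ballot_rec j m : (m <= j)%nat ->
  INR (S (S j)) * (Binomial.C (2 * S j + 1 - m) (S (S j)) / INR (S m))
  = 2 * (2 * INR (S j) + 1) * (Binomial.C (2 * j + 1 - m) (S j) / INR (S m)) + ballot j m.
Proof.
  intros Hm; replace j with (m + (j - m))%nat by lia.
  generalize (j - m)%nat; clear j Hm; intros i; unfold ballot, Binomial.C.
  replace (2 * S (m + i) + 1 - m)%nat with (S (S (S (m + i + i)))) by lia.
  replace (2 * (m + i) + 1 - m)%nat with (S (m + i + i)) by lia.
  replace (S (S (S (m + i + i))) - S (S (m + i)))%nat with (S i) by lia.
  replace (S (m + i + i) - S (m + i))%nat with i by lia.
  replace (S (m + i + i) - (m + i))%nat with (S i) by lia.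
  rewrite !fact_simpl, !mult_INR, !S_INR, !plus_INR.
  pose proof (pos_INR m); pose proof (pos_INR i).
  field; repeat split; try apply INR_fact_neq_0; lra.
Qed.

Lemma sin_binomial_sum_rec k :
  (INR k + 1) * sin_binomial_sum (S k) = 2 * (2 * INR k + 1) * sin_binomial_sum k - 2 ^ k.
Proof.
  destruct k as [|j].
  - rewrite sin_binomial_sum_0, sin_binomial_sum_S, sum_O, sin_seq_1.
    unfold Binomial.C; simpl; field.
  - rewrite <- S_INR, !sin_binomial_sum_S.
    replace (2 ^ S j) with (- (- 2 ^ S j)) by ring; rewrite <- (sum_sin_seq_ballot j).
    (* The top term m = j + 1 is split off: there the termwise relation fails, as
       [Binomial.C j (S j)] is not 0 under truncated subtraction. The top terms of the two sums
       match directly. *)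
    rewrite (sum_n_RS _ j), (sum_n_RS _ j), ballot_diag.
    rewrite (Rmult_plus_distr_l (INR (S (S j)))), <- !sum_n_Rscal.
    rewrite (sum_n_Rext _ (fun m =>
        2 * (2 * INR (S j) + 1) * (sin_seq (S m) / INR (S m) * Binomial.C (2 * j + 1 - m) (S j))
        + sin_seq (S m) * ballot j m)), sum_n_Rplus.
    + unfold Binomial.C; replace (2 * S j + 1 - S j)%nat with (S (S j)) by lia.
      rewrite Nat.sub_diag; simpl (fact 0); simpl (INR 1).
      field; split; [apply INR_fact_neq_0 | apply not_0_INR; lia].
    + intros m Hm.
      transitivity (sin_seq (S m) *
        (INR (S (S j)) * (Binomial.C (2 * S j + 1 - m) (S (S j)) / INR (S m)))).
      { unfold Rdiv; ring. }
      rewrite binomial_ballot_rec by exact Hm; unfold Rdiv; ring.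
Qed.

Lemma arctan_moment_1_S k :
  arctan_moment (S k) 1 = ((2 * INR k + 1) * arctan_moment k 1 - 1 / 2) / (INR k + 1).
Proof.
  simpl arctan_moment; rewrite pow1, pow_add; f_equal; f_equal.
  replace (1 + 1 * (1 * 1)) with 2 by ring.
  field; apply pow_nonzero; lra.
Qed.

(** The first summand solves the homogeneous recurrence with the initial value arctan 1 = pi/4; the
    second is the particular solution starting at 0. *)
Lemma arctan_moment_1_closed k :
  arctan_moment k 1
  = PI / 4 * INR (odd_dfact k) / INR (fact k) + sin_binomial_sum k / 2 ^ k.
Proof.
  induction k as [|k IH].
  - rewrite sin_binomial_sum_0; simpl; rewrite atan_1; field.
  - assert (Hk : INR k + 1 <> 0) by (pose proof (pos_INR k); lra).
    assert (H2 : 2 ^ k <> 0) by (apply pow_nonzero; lra).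
    rewrite arctan_moment_1_S, IH.
    replace (sin_binomial_sum (S k))
      with ((2 * (2 * INR k + 1) * sin_binomial_sum k - 2 ^ k) / (INR k + 1))
      by (rewrite <- sin_binomial_sum_rec; field; exact Hk).
    change (odd_dfact (S k)) with ((2 * k + 1) * odd_dfact k)%nat.
    rewrite fact_simpl, !mult_INR, plus_INR, mult_INR, !S_INR; simpl (INR 0); simpl (2 ^ S k).
    field; repeat split; auto; apply INR_fact_neq_0.
Qed.

Lemma coefW_arctan_moment n :
  coefW n = (-1) ^ n * sum_n (fun k =>
    (-1) ^ k * INR (stirling2 n k * fact k) * arctan_moment k 1) n.
Proof.
  unfold coefW; f_equal.
  (* The second outer sum may start at k = 0, where its inner sum is empty; both sums then merge
     termwise. *)
  assert (H : forall f : nat -> R, f 0%nat = 0 -> sum_n_m f 1 n = sum_n f n).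
  { intros f Hf; destruct n as [|n]; unfold sum_n.
    - rewrite sum_n_n, Hf; apply (sum_n_m_zero (G := R_AbelianMonoid)); lia.
    - rewrite (sum_Sn_m _ 0) by lia; rewrite Hf; symmetry; apply Rplus_0_l. }
  rewrite H by (rewrite (sum_n_m_zero (G := R_AbelianMonoid)) by lia; apply Rmult_0_r).
  fold (sum_n (fun k => (-1) ^ k * INR (stirling2 n k) * INR (odd_dfact k)) n).
  rewrite <- sum_n_Rscal, <- sum_n_Rplus; apply sum_n_Rext; intros k _.
  fold (sin_binomial_sum k).
  rewrite arctan_moment_1_closed, mult_INR.
  field; split; [apply pow_nonzero; lra | apply INR_fact_neq_0].
Qed.

(** * The expansion of [W] *)

(** The coefficients are nonnegative, so the moduli are the terms of the same series at the real
    point |y|. *)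
Lemma is_series_stirling2_egf_Cmod (y : C) k :
  is_series (fun n => Cmod (Cexp_term y n * RtoC (INR (stirling2 n k * fact k)))%C)
    ((exp (Cmod y) - 1) ^ k).
Proof.
  apply is_series_RtoC_inv.
  pose proof (is_series_stirling2_egf (RtoC (Cmod y)) k) as H.
  rewrite Cexp_RtoC, <- RtoC_minus, <- RtoC_pow in H.
  refine (is_series_ext _ _ _ _ H); intros n; unfold Cexp_term.
  rewrite !Cmod_mult, Cmod_pow, !Cmod_R, !Rabs_right, <- RtoC_pow, <- !RtoC_mult.
  - reflexivity.
  - apply Rle_ge, pos_INR.
  - left; apply Rinv_0_lt_compat, INR_fact_lt_0.
Qed.

(** The remainder bound for k = 1 after the term n = 0, which vanishes because S(0,1) = 0. *)
Lemma Cmod_Cexp_minus_1 (y : C) : Cmod (Cexp y - 1) <= exp (Cmod y) - 1.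
Proof.
  pose proof (series_partial_dist _ _ _ 0 (is_series_stirling2_egf y 1)
                (is_series_stirling2_egf_Cmod y 1)) as H.
  rewrite sum_n_CO, sum_O in H.
  rewrite <- Cmod_opp.
  replace (- (Cexp y - 1))%C
    with (Cexp_term y 0 * RtoC (INR (stirling2 0 1 * fact 1)) - (Cexp y - 1) ^ 1)%C
    by (simpl; ring).
  pose proof (Cmod_ge_0 (Cexp_term y 0 * RtoC (INR (stirling2 0 1 * fact 1)))%C); lra.
Qed.

Lemma ln2_lt_1 : ln 2 < 1.
Proof.
  rewrite <- (ln_exp 1); apply ln_increasing; [lra|].
  pose proof (exp_ineq1 1 ltac:(lra)); lra.
Qed.

(** Since |Im z| < ln 2 < pi, the value is real only for real z, and then Re z < ln 2 makes it
    positive. *)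
Lemma Cexp_minus_half_off_cut (z : C) : Cmod z < ln 2 ->
  Im (2 * Cexp (- z) - 1)%C <> 0 \/ 0 < Re (2 * Cexp (- z) - 1)%C.
Proof.
  intros Hz.
  pose proof (re_le_Cmod z) as Hr; apply Rabs_le_between in Hr.
  pose proof (im_le_Cmod z) as Hi; apply Rabs_le_between in Hi.
  pose proof ln2_lt_1; pose proof PI2_1.
  destruct (Req_dec (Im z) 0) as [E|E].
  - right; replace (Re _) with (2 * exp (- Re z) - 1).
    + enough (/ 2 < exp (- Re z)) by lra.
      rewrite <- (exp_ln (/ 2)), ln_Rinv by lra; apply exp_increasing; lra.
    + unfold Re, Im in *; simpl; rewrite E, Ropp_0, cos_0, sin_0; ring.
  - left; replace (Im _) with (- (2 * exp (- Re z) * sin (Im z))).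
    + pose proof (exp_pos (- Re z)).
      apply Ropp_neq_0_compat, Rmult_integral_contrapositive_currified; [lra|].
      destruct (Rtotal_order (Im z) 0) as [L|[L|L]]; [|contradiction|].
      * rewrite <- (Ropp_involutive (Im z)), sin_neg.
        pose proof (sin_gt_0 (- Im z) ltac:(lra) ltac:(lra)); lra.
      * pose proof (sin_gt_0 (Im z) ltac:(lra) ltac:(lra)); lra.
    + unfold Re, Im in *; simpl; rewrite sin_neg; ring.
Qed.

Theorem theorem4p2 (z : C) (hz : (Cmod z < ln 2)%R) :
  is_series (fun n : nat => (RtoC (coefW n / INR (fact n)) * pow_n z n)%C) (W z).
Proof.
  set (x := (Cexp (- z) - 1)%C).
  set (q := exp (Cmod z) - 1).
  assert (Hq : 0 <= q < 1).
  { unfold q; split.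
    - pose proof (exp_le_compat 0 (Cmod z) (Cmod_ge_0 z)) as H; rewrite exp_0 in H; lra.
    - pose proof (exp_increasing _ _ hz) as H; rewrite exp_ln in H; lra. }
  assert (Hx : Cmod x < 1).
  { pose proof (Cmod_Cexp_minus_1 (- z)) as H; rewrite Cmod_opp in H; fold x q in H; lra. }
  set (e := fun k => arctan_moment k 1).
  set (c := fun n k => (Cexp_term (- z) n * RtoC (INR (stirling2 n k * fact k)))%C).
  set (p := fun n k => (RtoC ((-1) ^ k * e k) * c n k)%C).
  assert (Hs : forall k, Rabs ((-1) ^ k * e k) <= 1).
  { intros k; rewrite Rabs_mult, pow_1_abs, Rmult_1_l.
    apply arctan_moment_1_bound. }
  (* Row n of [p] collects the power z^n, and column k sums to the term in x^k. The sign (-1)^n of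
     [coefW] comes from expanding at -z. *)
  apply (is_series_ext (V := C_NormedModule) (fun n => sum_n (p n) n)).
  { intros n; match goal with |- ?a = ?b => change (a = b :> C) end.
    rewrite coefW_arctan_moment; unfold p, c.
    rewrite (sum_n_Cext _ (fun k => Cexp_term (- z) n *
       RtoC ((-1) ^ k * INR (stirling2 n k * fact k) * arctan_moment k 1))%C)
      by (intros k _; unfold e; rewrite !RtoC_mult; ring).
    rewrite sum_n_Cscal, sum_n_RtoC; unfold Cexp_term, Rdiv.
    rewrite !RtoC_mult, (RtoC_pow (-1) n).
    replace (pow_n z n) with (z ^ n)%C
      by (induction n as [|n IH]; [reflexivity | simpl; rewrite IH; reflexivity]).
    replace (- z)%C with (RtoC (-1) * z)%C by ring.
    rewrite Cpow_mult_l; ring. }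
  apply (is_series_triangle p (fun k => (- x) ^ k * RtoC (e k))%C
           (fun k => Rabs ((-1) ^ k * e k) * q ^ k)).
  - intros n k Hnk; unfold p, c.
    replace (stirling2 n k) with 0%nat; [simpl; ring|].
    symmetry; revert k Hnk; induction n as [|n IH]; intros [|k] Hk; try lia; [reflexivity|].
    simpl stirling2; rewrite !IH by lia; lia.
  - intros k.
    replace ((- x) ^ k * RtoC (e k))%C with (RtoC ((-1) ^ k * e k) * x ^ k)%C.
    + apply (is_series_scal (RtoC ((-1) ^ k * e k)) _ _ (is_series_stirling2_egf (- z) k)).
    + replace (- x)%C with (RtoC (-1) * x)%C by ring.
      rewrite Cpow_mult_l, RtoC_mult, RtoC_pow; ring.
  - intros k.
    apply (is_series_ext (fun n => Rabs ((-1) ^ k * e k) * Cmod (c n k))).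
    { intros n; unfold p; rewrite Cmod_mult, Cmod_R; reflexivity. }
    pose proof (is_series_stirling2_egf_Cmod (- z) k) as H; rewrite Cmod_opp in H.
    apply (is_series_scal (Rabs ((-1) ^ k * e k)) _ _ H).
  (* The moments at 1 have modulus at most 1, so the column bounds are dominated by the geometric
     series of q = e^|z| - 1 < 1. *)
  - apply (ex_series_le (V := R_CompleteNormedModule) _ (fun k => q ^ k)).
    + intros k; pose proof (pow_le q k (proj1 Hq)) as H.
      change (norm ?a) with (Rabs a).
      rewrite Rabs_right by (apply Rle_ge, Rmult_le_pos; [apply Rabs_pos | exact H]).
      pose proof (Hs k); nra.
    + eexists; apply is_series_geom; rewrite Rabs_right; lra.
  - apply is_series_Carctan_div; [exact Hx | |].
    + apply Csqrt_Re_pos, Cexp_minus_half_off_cut, hz.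
    + rewrite Csqrt_sqr; unfold x; ring.
Qed.
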